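(* Let $M, d \geq 1$ be integers with $d \geq 2$, let $\mathcal{T} = (\eta_2^{\mathrm{p}}, \eta_1^{\mathrm{e}}, \eta_2^{\mathrm{e}})$ be an energy triple, and let $r \in \mathbb{R}$. Let $G = \frac1M\{0,1,\dots,M-1\}^d$. Then for every $w: G \to \mathbb{R}$ $$ \epsilon_{\mathcal{T}}(w) - \epsilon_{\mathcal{T}}(w_r) = \sum_{R \text{ row}} g_R(w, r) \left(\sum_{\mathbf{x} \in R} w(\mathbf{x}) - r\right), $$ where the outer sum runs over all rows $R$ of $G$ (in all directions $k=1,\dots,d$), $w_r: G \to \mathbb{R}$ is the constant weight $w_r(\mathbf{x}) = \frac{r}{M}$, and $g_R(w,r) = \sum_{\mathbf{x} \in G} \alpha_R^{\mathbf{x}}\, w(\mathbf{x}) + \alpha_R^r\, r$ with the explicit coefficients $\alpha_R^{\mathbf{x}}$, $\alpha_R^r$ given in the context.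
   Context: Energy triple: a triple $\mathcal{T} = (\eta_2^{\mathrm{p}}, \eta_1^{\mathrm{e}}, \eta_2^{\mathrm{e}})$ of real-valued functions such that (i) $\eta_2^{\mathrm{p}}: [0,1)^2 \to \mathbb{R}$ is symmetric and for all $M \in \mathbb{N}$ the sum $\sum_{n=0}^{M-1} \eta_2^{\mathrm{p}}(\frac mM, \frac nM)$ equals a constant $T = T(M)$ not depending on $m \in \{0,\dots,M-1\}$; one sets $\eta(s) = \eta_2^{\mathrm{p}}(s,0)$; (ii) $\eta_1^{\mathrm{e}}: [0,1) \to \mathbb{R}$, $\eta_1^{\mathrm{e}}(s) = \eta(0)-\eta(s)$; (iii) $\eta_2^{\mathrm{e}}: [0,1)^2 \to \mathbb{R}$, $\eta_2^{\mathrm{e}}(s,t) = \eta(0)-\eta(s)-\eta(t)+\eta_2^{\mathrm{p}}(s,t)$. For $\mathbf{x},\mathbf{y} \in [0,1)^d$ set $\eta_2^{\mathrm{p}}(\mathbf{x},\mathbf{y}) = \prod_{k=1}^d \eta_2^{\mathrm{p}}(x_k,y_k)$, $\eta_1^{\mathrm{e}}(\mathbf{x}) = \prod_{k=1}^d \eta_1^{\mathrm{e}}(x_k)$, $\eta_2^{\mathrm{e}}(\mathbf{x},\mathbf{y}) = \prod_{k=1}^d \eta_2^{\mathrm{e}}(x_k,y_k)$. Energies and excess: for $w: G \to \mathbb{R}$, $$E^{\mathrm{extr}}_{\mathcal{T}}(w) = -2\Big(\sum_{\mathbf{x}\in G} w(\mathbf{x})\Big)\sum_{\mathbf{x}\in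 G} w(\mathbf{x})\,\eta_1^{\mathrm{e}}(\mathbf{x}) + \sum_{\mathbf{x},\mathbf{y}\in G} w(\mathbf{x})w(\mathbf{y})\,\eta_2^{\mathrm{e}}(\mathbf{x},\mathbf{y}), \quad E^{\mathrm{per}}_{\mathcal{T}}(w) = \sum_{\mathbf{x},\mathbf{y}\in G} w(\mathbf{x})w(\mathbf{y})\,\eta_2^{\mathrm{p}}(\mathbf{x},\mathbf{y}),$$ and $\epsilon_{\mathcal{T}}(w) = E^{\mathrm{per}}_{\mathcal{T}}(w) - E^{\mathrm{extr}}_{\mathcal{T}}(w)$. Rows: write $[d] = \{1,\dots,d\}$. For $k \in [d]$ and fixed $m_1,\dots,m_{k-1},m_{k+1},\dots,m_d \in \{0,\dots,M-1\}$, the set $\{\frac1M(m_1,\dots,m_d): m_k = 0,\dots,M-1\} \subseteq G$ is a $k$-row; a row is a $k$-row for some $k$ (rows with different directions $k$ are regarded as different). $R_k(\mathbf{x})$ denotes the unique $k$-row containing $\mathbf{x} \in G$. Coefficients: for $P, Q \subseteq [d]$ let $$\gamma(P,Q) = \begin{cases} 2 & P=Q=\emptyset \\ 0 & P=Q=[d] \\ 0 & P \neq \emptyset,\ Q=\emptyset \\ 0 & P=\emptyset,\ Q\neq\emptyset \\ -2(-1)^{\#P+\#Q} & \text{else.}\end{cases}$$ For $k \in [d]$ and $\mathbf{x},\mathbf{y}\in G$ set $$\alpha^{\mathbf{x}}_{R_k(\mathbf{y})} = \sum_{\substack{P,Q\subseteq[d]\\ k\notin Q}} \frac{\gamma(P,Q)}{2d-\#P-\#Q}\,\eta(0)^{d-\#(P\cup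 Q)} \prod_{\ell\in P\setminus Q}\eta(x_\ell)\prod_{\ell\in Q\setminus P}\eta(y_\ell)\prod_{\ell\in P\cap Q}\eta_2^{\mathrm{p}}(x_\ell,y_\ell),$$ $$\alpha^{r}_{R_k(\mathbf{x})} = \sum_{\substack{P,Q\subseteq[d]\\ Q\neq[d]\\ k\notin P\setminus Q}} \frac{M^{d-1}}{d-\#(P\setminus Q)}\cdot\frac{d-\#Q}{2d-\#P-\#Q}\Big(\frac TM\Big)^{\#Q}\gamma(P,Q)\,\eta(0)^{d-\#(P\cup Q)}\prod_{\ell\in P\setminus Q}\eta(x_\ell),$$ with $T = T(M)$ and the convention $0^0=1$. The first quantity does not depend on $y_k$ and the second does not depend on $x_k$, so for a $k$-row $R$ the numbers $\alpha_R^{\mathbf{x}}$ and $\alpha_R^r$ are well defined by choosing any representative of $R$. (The superscript $r$ in $\alpha_R^r$ is only a label; $\alpha_R^r$ does not depend on the value of $r$.) *)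

(* Defs.v *)
From HB Require Import structures.
From mathcomp Require Import all_boot all_order all_algebra.
From mathcomp Require Import reals.

Set Implicit Arguments.
Unset Strict Implicit.
Unset Printing Implicit Defensive.

Import Order.TTheory GRing.Theory Num.Theory.
Local Open Scope ring_scope.

Definition in01 (R : realType) (s : R) : Prop := 0 <= s < 1.

(* The functions are total on R, but all axioms concern arguments in [0,1)
   only, and the functions are only ever evaluated there. *)
Record energy_triple (R : realType) := EnergyTriple {
  eta2p : R -> R -> R;
  eta1e : R -> R;
  eta2e : R -> R -> R;
  eta2p_sym : forall s t : R, in01 s -> in01 t -> eta2p s t = eta2p t s;
  eta2p_rowsum : forall M : nat, exists T : R, forall m : 'I_M,
    \sum_(n < M) eta2p (m%:R / M%:R) (n%:R / M%:R) = T;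
  eta1eE : forall s : R, in01 s -> eta1e s = eta2p 0 0 - eta2p s 0;
  eta2eE : forall s t : R, in01 s -> in01 t ->
    eta2e s t = eta2p 0 0 - eta2p s 0 - eta2p t 0 + eta2p s t
}.

Definition eta (R : realType) (tr : energy_triple R) (s : R) : R :=
  eta2p tr s 0.

(* The constant of axiom eta2p_rowsum, read off at m = 0; see Tsum_const. *)
Definition Tsum (R : realType) (tr : energy_triple R) (M : nat) : R :=
  \sum_(n < M) eta2p tr 0 (n%:R / M%:R).

Lemma Tsum_const (R : realType) (tr : energy_triple R) (M : nat) (m : 'I_M) :
  \sum_(n < M) eta2p tr (m%:R / M%:R) (n%:R / M%:R) = Tsum tr M.
Proof.
case: M m => [[]//|M] m.
have [T hT] := eta2p_rowsum tr M.+1.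
by rewrite hT /Tsum -(hT ord0) mul0r.
Qed.

Section Tensor.
Variables (R : realType) (tr : energy_triple R) (d : nat).

Definition eta2p_prod (x y : 'I_d -> R) : R := \prod_(k < d) eta2p tr (x k) (y k).
Definition eta1e_prod (x : 'I_d -> R) : R := \prod_(k < d) eta1e tr (x k).
Definition eta2e_prod (x y : 'I_d -> R) : R := \prod_(k < d) eta2e tr (x k) (y k).

End Tensor.

(* The grid point (m_1, ..., m_d) / M is encoded by its numerators
   (m_1, ..., m_d); pt gives its actual coordinates in [0,1). *)
Definition grid (M d : nat) := {ffun 'I_d -> 'I_M}.

Definition pt (R : realType) (M d : nat) (x : grid M d) : 'I_d -> R :=
  fun k => (x k : nat)%:R / M%:R.
Arguments pt R {M d} x _.

Section Energies.
Variables (R : realType) (tr : energy_triple R) (M d : nat).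
Implicit Types (w : grid M d -> R).

Definition Eextr w : R :=
  - 2 * (\sum_(x : grid M d) w x)
      * (\sum_(x : grid M d) w x * eta1e_prod tr (pt R x))
  + \sum_(x : grid M d) \sum_(y : grid M d)
      w x * w y * eta2e_prod tr (pt R x) (pt R y).

Definition Eper w : R :=
  \sum_(x : grid M d) \sum_(y : grid M d)
    w x * w y * eta2p_prod tr (pt R x) (pt R y).

Definition excess w : R := Eper w - Eextr w.

End Energies.

Section Rows.
Variables (M d : nat).

Definition krow (k : 'I_d) (x : grid M d) : {set grid M d} :=
  [set y : grid M d | [forall l : 'I_d, (l != k) ==> (y l == x l)]].

(* A row carries its direction: for M = 1 the same set of points is a row in
   each of the d directions, and these are to be counted separately. *)
Definition rows : {set 'I_d * {set grid M d}} :=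
  [set (k, krow k x) | k : 'I_d, x : grid M d].

End Rows.

Section Coefficients.
Variables (R : realType) (tr : energy_triple R) (M d : nat).
Implicit Types (P Q : {set 'I_d}) (k : 'I_d) (x y : grid M d).

Definition gamma P Q : R :=
  if (P == set0) && (Q == set0) then 2
  else if (P == setT) && (Q == setT) then 0
  else if (P != set0) && (Q == set0) then 0
  else if (P == set0) && (Q != set0) then 0
  else - 2 * (- 1) ^+ (#|P| + #|Q|).

Definition alphaX_at k y x : R :=
  \sum_(P : {set 'I_d}) \sum_(Q : {set 'I_d} | k \notin Q)
    gamma P Q / (2 * d%:R - #|P|%:R - #|Q|%:R)
    * eta tr 0 ^+ (d - #|P :|: Q|)
    * (\prod_(l in P :\: Q) eta tr (pt R x l))
    * (\prod_(l in Q :\: P) eta tr (pt R y l))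
    * (\prod_(l in P :&: Q) eta2p tr (pt R x l) (pt R y l)).

Definition alphaR_at k x : R :=
  \sum_(P : {set 'I_d})
   \sum_(Q : {set 'I_d} | (Q != setT) && (k \notin P :\: Q))
    M%:R ^+ (d - 1) / (d%:R - #|P :\: Q|%:R)
    * ((d%:R - #|Q|%:R) / (2 * d%:R - #|P|%:R - #|Q|%:R))
    * (Tsum tr M / M%:R) ^+ #|Q|
    * gamma P Q
    * eta tr 0 ^+ (d - #|P :|: Q|)
    * (\prod_(l in P :\: Q) eta tr (pt R x l)).

(* Evaluation at an arbitrary point of the row; alphaX_row and alphaR_row
   show that the choice of the point is irrelevant. Rows are never empty, so
   the default value 0 is not used. *)
Definition alphaX (r : 'I_d * {set grid M d}) x : R :=
  if [pick y in r.2] is Some y then alphaX_at r.1 y x else 0.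

Definition alphaR (r : 'I_d * {set grid M d}) : R :=
  if [pick y in r.2] is Some y then alphaR_at r.1 y else 0.

Lemma krowP k x y : reflect (forall l, l != k -> y l = x l) (y \in krow k x).
Proof.
rewrite inE; apply: (iffP forallP) => [h l lk|h l].
  by move: (h l); rewrite lk => /eqP.
by apply/implyP => lk; rewrite h.
Qed.

Lemma alphaX_row k y x : alphaX (k, krow k y) x = alphaX_at k y x.
Proof.
rewrite /alphaX /=; case: pickP => [z /krowP zy|/(_ y)]; last first.
  by move=> /negP[]; apply/krowP.
have ptE l : l != k -> pt R z l = pt R y l by move=> /zy lk; rewrite /pt lk.
apply: eq_bigr => P _; apply: eq_bigr => Q kQ.
have neq l : l \in Q -> l != k by apply: contraTneq => ->.
congr (_ * _ * _); apply: eq_bigr => l.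
  by rewrite inE => /andP[_ /neq /ptE ->].
by rewrite inE => /andP[_ /neq /ptE ->].
Qed.

Lemma alphaR_row k x : alphaR (k, krow k x) = alphaR_at k x.
Proof.
rewrite /alphaR /=; case: pickP => [z /krowP zx|/(_ x)]; last first.
  by move=> /negP[]; apply/krowP.
apply: eq_bigr => P _; apply: eq_bigr => Q /andP[_ kPQ].
congr (_ * _); apply: eq_bigr => l lPQ.
by rewrite /pt zx //; apply: contraTneq lPQ => ->.
Qed.

Definition g (r : 'I_d * {set grid M d}) (w : grid M d -> R) (c : R) : R :=
  \sum_(x : grid M d) alphaX r x * w x + alphaR r * c.

End Coefficients.

(* Main.v *)
Require Import Defs.
From mathcomp Require Import all_boot all_order all_algebra.
From mathcomp Require Import reals.
From mathcomp Require Import ring.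
Import Order.TTheory GRing.Theory Num.Theory.
Local Open Scope ring_scope.

Set Implicit Arguments.
Unset Strict Implicit.

(** The excess is a quadratic form. Expanding every product over the d
    coordinates gives
      2 * excess w = sum_(x, y) w x * w y * sum_(P, Q) gamma P Q * F P Q x y,
    where F P Q x y is the monomial in the values of eta and eta2p that depends
    on x through its coordinates in P and on y through those in Q
    ([excessE]).

    Since F P Q x y ignores y_k for k outside Q, the monomial can be attached
    to any of the k-rows through y with k outside Q. There are d - #|Q| of
    them, and d - #|P| in the mirrored choice which attaches it to rows through
    x; giving each choice the weight 1 / (2d - #|P| - #|Q|) is an even split.
    Thus, with A y x the sum over k of alpha^x on R_k(y), and B y that of
    alpha^r on R_k(y):
    - the quadratic form with kernel A is again the excess ([excess_alphaX]),
      by the symmetry (P, x) <-> (Q, y);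
    - summing over y, each coordinate in Q yields the constant row sum T and
      each other coordinate a factor M, which gives sum_y A y x = M * B x
      ([sum_alphaX_alphaR]): this is what the coefficients alpha^r are made
      for.

    Put v = r / M. A row has M points, so its residual sum_(x in R) w x - r is
    the sum of w x - v over its points, and a sum over rows becomes a sum over
    pairs of a direction and a point ([sum_rows_residual]). The right-hand side
    is then
      sum_y (w y - v) * (sum_x A y x * w x + v * sum_z A z y),
    in which the mixed terms cancel; sum_(x, y) A y x * (w y * w x - v * v)
    remains, which is the difference of the two excesses. *)

Lemma prodrB_subsets (R : comPzRingType) (I : finType) (a b : I -> R) :
  \prod_i (a i - b i) =
  \sum_(J : {set I}) (-1) ^+ #|J| * \prod_i (if i \in J then b i else a i).
Proof.
under eq_bigr do rewrite addrC.
rewrite bigA_distr; apply: eq_bigr => J _.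
rewrite -prodr_const [X in _ = X * _]big_mkcond -big_split /=; apply: eq_bigr => i _.
by case: ifP; rewrite ?mul1r ?mulN1r.
Qed.

(** * Sums over rows *)

Section GridRows.
Variables (R : realType) (M d : nat).
Hypothesis M_gt0 : (0 < M)%N.

Lemma card_krow (k : 'I_d) (x : grid M d) : #|krow k x| = M.
Proof.
pose f (m : 'I_M) : grid M d := [ffun l => if l == k then m else x l].
have f_inj : injective f by move=> m n /ffunP/(_ k); rewrite !ffunE eqxx.
rewrite -[RHS](card_ord M) -(card_imset _ f_inj).
congr #|pred_of_set _|; apply/setP => y.
apply/krowP/imsetP => [yx|[m _ ->] l /negPf lk]; last by rewrite ffunE lk.
exists (y k) => //; apply/ffunP => l; rewrite ffunE.
by case: eqP => [->|/eqP/yx].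
Qed.

Lemma krow_refl (k : 'I_d) (x : grid M d) : x \in krow k x.
Proof. exact/krowP. Qed.

Lemma krow_eq (k : 'I_d) (x y : grid M d) : y \in krow k x -> krow k y = krow k x.
Proof.
move=> /krowP yx; apply/setP => z.
by apply/krowP/krowP => zy l lk; rewrite zy // yx.
Qed.

(** A pair of a direction k and a point x amounts to a row in direction k with
    a marked point; rows carry their direction, so this stays true when
    M = 1. *)
Lemma sum_rows (f : 'I_d * {set grid M d} -> R) (u : grid M d -> R) :
  \sum_(Row in rows M d) f Row * (\sum_(x in Row.2) u x) =
  \sum_(k < d) \sum_(x : grid M d) f (k, krow k x) * u x.
Proof.
rewrite pair_big /=.
have -> : rows M d = [set (p.1, krow p.1 p.2) | p in predT].
  apply/setP => r; apply/imset2P/imsetP => [[k x _ _ ->]|[[k x] _ ->]].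
    by exists (k, x).
  by exists k x.
rewrite [RHS](partition_big_imset (fun p : 'I_d * grid M d => (p.1, krow p.1 p.2))) /=.
apply: eq_bigr => _ /imsetP[[k x] _ ->] /=.
rewrite mulr_sumr (reindex_onto (pair k) snd) /=; last first.
  by case=> i y /= /eqP[->].
rewrite big_mkcond [RHS]big_mkcond; apply: eq_bigr => y _ /=.
rewrite !eqxx andbT xpair_eqE eqxx /=.
case: eqP => [e|ne]; first by rewrite -e krow_refl.
by case: ifP => // /krow_eq.
Qed.

(** The constant r is spread evenly, as r / M, over the M points of each row. *)
Lemma sum_rows_residual (f : 'I_d * {set grid M d} -> R) (u : grid M d -> R)
    (r : R) :
  \sum_(Row in rows M d) f Row * (\sum_(x in Row.2) u x - r) =
  \sum_(x : grid M d) (\sum_(k < d) f (k, krow k x)) * (u x - r / M%:R).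
Proof.
under [RHS]eq_bigr do rewrite mulr_suml.
rewrite [RHS]exchange_big -(sum_rows f (fun x => u x - r / M%:R)).
apply: eq_bigr => _ /imset2P[k x _ _ ->] /=; congr (_ * _).
rewrite sumrB sumr_const card_krow -[(r / _) *+ _]mulr_natr divfK //.
by rewrite pnatr_eq0 -lt0n.
Qed.

End GridRows.

(** * Expansion of the kernel into monomials *)

Lemma in01_grid (R : realType) (M : nat) (m : 'I_M) : in01 (m%:R / M%:R : R).
Proof.
have M_gt0 : (0 < M%:R :> R) by rewrite ltr0n; case: M m => [[]|].
by rewrite /in01 divr_ge0 ?ler0n //= ltr_pdivrMr // mul1r ltr_nat.
Qed.

Lemma in01_0 (R : realType) : in01 (0 : R).
Proof. by rewrite /in01 lexx ltr01. Qed.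

(** The monomial indexed by (P, Q) in the expansion of the energy kernels.
    Writing it as a single product over the coordinates lets it be expanded,
    transposed and summed over y one coordinate at a time; [pair_termE] gives
    its shape in the coefficients alpha. *)
Definition pair_term (R : realType) (tr : energy_triple R) (d : nat)
    (P Q : {set 'I_d}) (x y : 'I_d -> R) : R :=
  \prod_l (if l \in Q then if l \in P then eta2p tr (x l) (y l) else eta tr (y l)
           else if l \in P then eta tr (x l) else eta tr 0).

Section Coefficients.
Variables (R : realType) (tr : energy_triple R) (d : nat).
Hypothesis d_gt0 : (0 < d)%N.
Implicit Types (P Q : {set 'I_d}).

Let set0NT : (set0 == [set: 'I_d]) = false.
Proof. by rewrite -subTset subset0 -cards_eq0 cardsT card_ord; case: d d_gt0. Qed.

Let setTN0 : ([set: 'I_d] == set0) = false.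
Proof. by rewrite eq_sym. Qed.

(** One summand for each of the four parts of the kernel: the periodic kernel
    contributes only (setT, setT), the one-point kernels in x and in y only
    the pairs with Q, respectively P, empty, and the two-point kernel
    contributes every pair. For d > 0 these families overlap so that the
    exceptional values of gamma come out. *)
Lemma gammaE P Q : gamma R P Q =
  2 * ((P == setT) && (Q == setT))%:R + 2 * (-1) ^+ #|P| * (Q == set0)%:R
  + 2 * (-1) ^+ #|Q| * (P == set0)%:R - 2 * (-1) ^+ (#|P| + #|Q|).
Proof.
rewrite /gamma.
have [->|P0] := eqVneq P set0; have [->|Q0] := eqVneq Q set0;
  rewrite ?set0NT ?setTN0 ?cards0 ?addn0 ?expr0 ?andbF /=; try by ring.
case: (eqVneq P setT) => [->|PT]; case: (eqVneq Q setT) => [->|QT] /=; try by ring.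
by rewrite cardsT -[_ ^+ (_ + _)]signr_odd oddD addbb; ring.
Qed.

Lemma gammaC P Q : gamma R P Q = gamma R Q P.
Proof. by rewrite !gammaE andbC [(#|P| + _)%N]addnC; ring. Qed.

Lemma gammaTT : gamma R [set: 'I_d] setT = 0.
Proof. by rewrite /gamma setTN0 !eqxx. Qed.

Lemma gammaT0 : gamma R [set: 'I_d] set0 = 0.
Proof. by rewrite /gamma set0NT setTN0 !eqxx. Qed.

Lemma sum_gamma_pair_term (x y : 'I_d -> R) :
    (forall l, in01 (x l)) -> (forall l, in01 (y l)) ->
  \sum_(P : {set 'I_d}) \sum_(Q : {set 'I_d}) gamma R P Q * pair_term tr P Q x y =
  2 * eta2p_prod tr x y + 2 * eta1e_prod tr x + 2 * eta1e_prod tr y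
  - 2 * eta2e_prod tr x y.
Proof.
move=> x01 y01.
have per : eta2p_prod tr x y = pair_term tr setT setT x y.
  by apply: eq_bigr => l _; rewrite !inE.
have ex : eta1e_prod tr x =
    \sum_(P : {set 'I_d}) (-1) ^+ #|P| * pair_term tr P set0 x y.
  rewrite /eta1e_prod; under eq_bigr do rewrite eta1eE //.
  rewrite prodrB_subsets; apply: eq_bigr => P _; congr (_ * _).
  by apply: eq_bigr => l _; rewrite inE.
have ey : eta1e_prod tr y =
    \sum_(Q : {set 'I_d}) (-1) ^+ #|Q| * pair_term tr set0 Q x y.
  rewrite /eta1e_prod; under eq_bigr do rewrite eta1eE //.
  rewrite prodrB_subsets; apply: eq_bigr => Q _; congr (_ * _).
  by apply: eq_bigr => l _; rewrite inE.
have exy : eta2e_prod tr x y =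
    \sum_(P : {set 'I_d}) \sum_(Q : {set 'I_d})
      (-1) ^+ (#|P| + #|Q|) * pair_term tr P Q x y.
  rewrite /eta2e_prod.
  transitivity (\prod_l ((eta tr 0 - eta tr (y l))
                         - (eta tr (x l) - eta2p tr (x l) (y l)))).
    by apply: eq_bigr => l _; rewrite eta2eE // /eta; ring.
  rewrite prodrB_subsets; apply: eq_bigr => P _.
  transitivity ((-1) ^+ #|P| *
    \prod_l ((if l \in P then eta tr (x l) else eta tr 0)
             - (if l \in P then eta2p tr (x l) (y l) else eta tr (y l)))).
    by congr (_ * _); apply: eq_bigr => l _; case: ifP.
  rewrite prodrB_subsets mulr_sumr; apply: eq_bigr => Q _.
  by rewrite exprD mulrA.
rewrite per exy ex ey !mulr_sumr.
have -> : 2 * pair_term tr setT setT x y = \sum_(P : {set 'I_d}) \sum_(Q : {set 'I_d})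
    2 * ((P == setT) && (Q == setT))%:R * pair_term tr P Q x y.
  rewrite (bigD1 setT) //= (bigD1 setT) //= !eqxx mulr1.
  rewrite [X in _ + X + _]big1 ?addr0; last first.
    by move=> Q /negPf ->; rewrite mulr0 mul0r.
  rewrite big1 ?addr0 // => P /negPf ->.
  by rewrite big1 // => Q _; rewrite mulr0 mul0r.
have -> : \sum_(P : {set 'I_d}) 2 * ((-1) ^+ #|P| * pair_term tr P set0 x y) =
    \sum_(P : {set 'I_d}) \sum_(Q : {set 'I_d})
    2 * (-1) ^+ #|P| * (Q == set0)%:R * pair_term tr P Q x y.
  apply: eq_bigr => P _; rewrite (bigD1 set0) //= eqxx mulr1 mulrA.
  by rewrite big1 ?addr0 // => Q /negPf ->; rewrite mulr0 mul0r.
have -> : \sum_(Q : {set 'I_d}) 2 * ((-1) ^+ #|Q| * pair_term tr set0 Q x y) =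
    \sum_(P : {set 'I_d}) \sum_(Q : {set 'I_d})
    2 * (-1) ^+ #|Q| * (P == set0)%:R * pair_term tr P Q x y.
  rewrite exchange_big.
  apply: eq_bigr => Q _; rewrite (bigD1 set0) //= eqxx mulr1 mulrA.
  by rewrite big1 ?addr0 // => P /negPf ->; rewrite mulr0 mul0r.
rewrite -!big_split -sumrB; apply: eq_bigr => P _ /=.
rewrite mulr_sumr -!big_split -sumrB; apply: eq_bigr => Q _ /=.
by rewrite gammaE; ring.
Qed.

Lemma pair_termC P Q (x y : 'I_d -> R) :
    (forall l, in01 (x l)) -> (forall l, in01 (y l)) ->
  pair_term tr P Q x y = pair_term tr Q P y x.
Proof.
move=> x01 y01; apply: eq_bigr => l _.
by case: ifP => // lQ; case: ifP => // lP; rewrite eta2p_sym.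
Qed.

Lemma pair_termE P Q (x y : 'I_d -> R) : pair_term tr P Q x y =
  eta tr 0 ^+ (d - #|P :|: Q|)
  * (\prod_(l in P :\: Q) eta tr (x l)) * (\prod_(l in Q :\: P) eta tr (y l))
  * (\prod_(l in P :&: Q) eta2p tr (x l) (y l)).
Proof.
have -> : (d - #|P :|: Q| = #|~: (P :|: Q)|)%N by rewrite [RHS]cardsCs setCK card_ord.
rewrite -prodr_const /pair_term.
rewrite !(big_mkcond (fun l => l \in _)) -!big_split; apply: eq_bigr => l _ /=.
by rewrite !inE; case: (l \in P); case: (l \in Q) => /=; ring.
Qed.

(** Double counting: Q occurs once for each k outside A Q. *)
Lemma sum_notin (f : {set 'I_d} -> R) (c : pred {set 'I_d})
    (A : {set 'I_d} -> {set 'I_d}) :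
  \sum_(k < d) \sum_(Q | c Q && (k \notin A Q)) f Q =
  \sum_(Q | c Q) (d%:R - #|A Q|%:R) * f Q.
Proof.
rewrite (exchange_big_dep c) /=; last by move=> k Q _ /andP[].
apply: eq_bigr => Q ->.
rewrite (eq_bigl (fun k => k \in ~: A Q)); last by move=> k; rewrite inE.
rewrite sumr_const cardsCs setCK card_ord -[f Q *+ _]mulr_natl natrB //.
by rewrite -[X in (_ <= X)%N]card_ord max_card.
Qed.

End Coefficients.

Section Excess.
Variables (R : realType) (tr : energy_triple R) (M d : nat).
Hypotheses (M_gt0 : (0 < M)%N) (d_gt0 : (0 < d)%N).
Implicit Types (P Q : {set 'I_d}) (x y : grid M d) (w : grid M d -> R).

Lemma M_neq0 : M%:R != 0 :> R.
Proof. by rewrite pnatr_eq0 -lt0n. Qed.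

(** The product of the total weight with the one-point energy is symmetrized
    in x and y, so that the excess becomes one quadratic form. *)
Lemma excessE w : excess tr w =
  2^-1 * \sum_(x : grid M d) \sum_(y : grid M d) w x * w y *
    \sum_(P : {set 'I_d}) \sum_(Q : {set 'I_d})
      gamma R P Q * pair_term tr P Q (pt R x) (pt R y).
Proof.
have ex x y : \sum_(P : {set 'I_d}) \sum_(Q : {set 'I_d})
      gamma R P Q * pair_term tr P Q (pt R x) (pt R y) =
    2 * eta2p_prod tr (pt R x) (pt R y) + 2 * eta1e_prod tr (pt R x)
    + 2 * eta1e_prod tr (pt R y) - 2 * eta2e_prod tr (pt R x) (pt R y).
  by apply: sum_gamma_pair_term => // l; apply: in01_grid.
under eq_bigr do under eq_bigr do rewrite ex.
set S := \sum_(x : grid M d) w x.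
set E := \sum_(x : grid M d) w x * eta1e_prod tr (pt R x).
have S1 : \sum_(x : grid M d) \sum_(y : grid M d) w x * w y * eta1e_prod tr (pt R x) =
    S * E.
  rewrite mulr_sumr; apply: eq_bigr => x _; rewrite mulr_suml.
  by apply: eq_bigr => y _; ring.
have S2 : \sum_(x : grid M d) \sum_(y : grid M d) w x * w y * eta1e_prod tr (pt R y) =
    S * E.
  rewrite mulr_suml; apply: eq_bigr => x _; rewrite mulr_sumr.
  by apply: eq_bigr => y _; ring.
rewrite /excess /Eper /Eextr -/S -/E.
transitivity (\sum_(x : grid M d) \sum_(y : grid M d)
      w x * w y * eta2p_prod tr (pt R x) (pt R y)
  + \sum_(x : grid M d) \sum_(y : grid M d) w x * w y * eta1e_prod tr (pt R x)
  + \sum_(x : grid M d) \sum_(y : grid M d) w x * w y * eta1e_prod tr (pt R y)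
  - \sum_(x : grid M d) \sum_(y : grid M d)
      w x * w y * eta2e_prod tr (pt R x) (pt R y)).
  by rewrite S1 S2; ring.
rewrite -!big_split -sumrB mulr_sumr; apply: eq_bigr => x _ /=.
rewrite -!big_split -sumrB mulr_sumr; apply: eq_bigr => y _ /=.
by field.
Qed.

(** The part of gamma P Q that is attached to the rows through y, namely
    d - #|Q| equal shares out of (d - #|Q|) + (d - #|P|). *)
Definition gamma_share P Q : R :=
  (d%:R - #|Q|%:R) / (2 * d%:R - #|P|%:R - #|Q|%:R) * gamma R P Q.

(** The two parts make up gamma; the denominator vanishes only for
    P = Q = setT, where gamma is 0. *)
Lemma gamma_shareC P Q : gamma_share P Q + gamma_share Q P = gamma R P Q.
Proof.
rewrite /gamma_share [gamma R Q P]gammaC //.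
have [/andP[/eqP -> /eqP ->]|PQ] := boolP ((P == setT) && (Q == setT)).
  by rewrite gammaTT // !mulr0 addr0.
rewrite [2 * _ - _ - #|P|%:R]addrAC -mulrDl -mulrDl.
have -> : d%:R - #|Q|%:R + (d%:R - #|P|%:R) = 2 * d%:R - #|P|%:R - #|Q|%:R :> R by ring.
rewrite divff ?mul1r //.
have cd (A : {set 'I_d}) : (#|A| <= d ?= iff (A == setT))%N.
  have := subset_leqif_cards (subsetT A); rewrite cardsT card_ord.
  by [].
have := leqif_add (cd P) (cd Q) => - [_ h].
apply: contraNneq PQ => h0; rewrite -h -(eqr_nat R) !natrD -subr_eq0.
by apply/eqP; rewrite -[RHS]oppr0 -h0; ring.
Qed.

(** * The coefficients of the rows through a point *)

Lemma sum_alphaX y x : \sum_(k < d) alphaX_at tr k y x =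
  \sum_(P : {set 'I_d}) \sum_(Q : {set 'I_d})
    gamma_share P Q * pair_term tr P Q (pt R x) (pt R y).
Proof.
rewrite exchange_big; apply: eq_bigr => P _ /=.
rewrite (sum_notin (fun Q => gamma R P Q / (2 * d%:R - #|P|%:R - #|Q|%:R)
    * eta tr 0 ^+ (d - #|P :|: Q|)
    * (\prod_(l in P :\: Q) eta tr (pt R x l))
    * (\prod_(l in Q :\: P) eta tr (pt R y l))
    * (\prod_(l in P :&: Q) eta2p tr (pt R x l) (pt R y l))) predT id) /=.
by apply: eq_bigr => Q _; rewrite pair_termE /gamma_share; ring.
Qed.

(** Adding the sum to its transpose turns the shares back into gamma. *)
Lemma excess_alphaX w :
  \sum_(x : grid M d) \sum_(y : grid M d)
    w x * w y * (\sum_(k < d) alphaX_at tr k y x) = excess tr w.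
Proof.
rewrite excessE; set A := LHS.
suff e : A + A = \sum_(x : grid M d) \sum_(y : grid M d) w x * w y *
    \sum_(P : {set 'I_d}) \sum_(Q : {set 'I_d})
      gamma R P Q * pair_term tr P Q (pt R x) (pt R y).
  by rewrite -e; field.
rewrite {2}/A exchange_big -big_split; apply: eq_bigr => x _ /=.
rewrite -big_split; apply: eq_bigr => y _ /=.
rewrite [w y * w x]mulrC -mulrDr; congr (_ * _).
rewrite !sum_alphaX [X in _ + X]exchange_big -big_split.
apply: eq_bigr => P _ /=; rewrite -big_split; apply: eq_bigr => Q _ /=.
rewrite -gamma_shareC mulrDl [pair_term tr Q P _ _]pair_termC // => l; exact: in01_grid.
Qed.

(** The coordinates of y vary independently: a coordinate in Q contributes the
    row sum T, whether paired with x_l or with 0, and the others M. *)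
Lemma sum_pair_term P Q x : \sum_(y : grid M d) pair_term tr P Q (pt R x) (pt R y) =
  M%:R ^+ d * (Tsum tr M / M%:R) ^+ #|Q| * eta tr 0 ^+ (d - #|P :|: Q|)
  * (\prod_(l in P :\: Q) eta tr (pt R x l)).
Proof.
have -> : (d - #|P :|: Q| = #|~: (P :|: Q)|)%N by rewrite [RHS]cardsCs setCK card_ord.
rewrite -[X in M%:R ^+ X]card_ord -!prodr_const /pair_term.
rewrite -(bigA_distr_bigA (fun l (m : 'I_M) =>
  if l \in Q then if l \in P then eta2p tr (pt R x l) (m%:R / M%:R)
                  else eta tr (m%:R / M%:R)
  else if l \in P then eta tr (pt R x l) else eta tr 0)).
rewrite !(big_mkcond (fun l => l \in _)) -!big_split; apply: eq_bigr => l _ /=.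
have M0 := M_neq0.
rewrite !inE; case: (l \in Q); case: (l \in P) => /=.
- by rewrite Tsum_const; field.
- have -> : \sum_(m < M) eta tr (m%:R / M%:R) = Tsum tr M.
    apply: eq_bigr => m _.
    by rewrite /eta eta2p_sym //; [exact: in01_grid | exact: in01_0].
  by field.
- by rewrite sumr_const card_ord -[eta tr _ *+ _]mulr_natl; ring.
- by rewrite sumr_const card_ord -[eta tr _ *+ _]mulr_natl; ring.
Qed.

(** The definition of alpha^r leaves out Q = setT, where the share of gamma is
    0, and its denominator d - #|P :\: Q| is the number of directions k that
    reach the pair (P, Q). No direction does when P :\: Q = setT, that is,
    P = setT and Q = set0, but there gamma is 0. *)
Lemma sum_alphaR x : \sum_(k < d) alphaR_at tr k x =
  \sum_(P : {set 'I_d}) \sum_(Q : {set 'I_d})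
  gamma_share P Q * (M%:R ^+ (d - 1) * (Tsum tr M / M%:R) ^+ #|Q|
    * eta tr 0 ^+ (d - #|P :|: Q|) * (\prod_(l in P :\: Q) eta tr (pt R x l))).
Proof.
rewrite exchange_big; apply: eq_bigr => P _ /=.
rewrite (sum_notin _ (fun Q => Q != setT) (fun Q => P :\: Q)) /=.
rewrite [RHS](bigD1 setT) //= {1}/gamma_share cardsT card_ord subrr !mul0r add0r.
apply: eq_bigr => Q _.
have [PQ|PQ] := eqVneq (P :\: Q) setT.
  have PT : P = setT by apply/eqP; rewrite -subTset -PQ subsetDl.
  have Q0 : Q = set0 by rewrite -[Q]setCK -[~: Q]setTD -PT PQ setCT.
  by rewrite /gamma_share PT Q0 gammaT0 // !(mulr0, mul0r).
have PQd : d%:R - #|P :\: Q|%:R != 0 :> R.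
  rewrite subr_eq0 eqr_nat eq_sym -[X in _ == X]card_ord -cardsT.
  apply: contraNN PQ => /eqP e.
  by rewrite eqEcard subsetT /= e.
rewrite /gamma_share -[RHS](mulVKf PQd).
by ring.
Qed.

(** Each row has M points, so this says that the sum of alpha^x over all rows
    equals the sum of alpha^r over the d rows through x. Hence the terms of
    the decomposition that are linear in w cancel. *)
Lemma sum_alphaX_alphaR x : \sum_(y : grid M d) \sum_(k < d) alphaX_at tr k y x =
  M%:R * \sum_(k < d) alphaR_at tr k x.
Proof.
under eq_bigr do rewrite sum_alphaX.
rewrite sum_alphaR exchange_big mulr_sumr; apply: eq_bigr => P _ /=.
rewrite exchange_big mulr_sumr; apply: eq_bigr => Q _ /=.
rewrite -mulr_sumr sum_pair_term.
have -> : M%:R ^+ d = M%:R * M%:R ^+ (d - 1) :> R by rewrite subn1 -exprS prednK.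
by ring.
Qed.

End Excess.

(** * The row decomposition of the excess *)

Theorem proposition2p8 (R : realType) (M d : nat) (hM : (1 <= M)%N)
    (hd : (2 <= d)%N) (tr : energy_triple R) (r : R) (w : grid M d -> R) :
  excess tr w - excess tr (fun _ : grid M d => r / M%:R) =
  \sum_(Row in rows M d) g tr Row w r * (\sum_(x in Row.2) w x - r).
Proof.
have d_gt0 : (0 < d)%N by exact: ltnW.
rewrite sum_rows_residual // -!excess_alphaX //; set v := r / M%:R.
have rE : r = v * M%:R by rewrite /v divfK // M_neq0.
pose A (y x : grid M d) := \sum_(k < d) alphaX_at tr k y x.
have gE y : \sum_(k < d) g tr (k, krow k y) w r =
    \sum_(x : grid M d) A y x * w x + v * \sum_(z : grid M d) A z y.
  rewrite /A sum_alphaX_alphaR // mulrA -rE mulr_sumr.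
  rewrite (eq_bigr (fun k => \sum_(x : grid M d) alphaX_at tr k y x * w x
                              + r * alphaR_at tr k y)); last first.
    move=> k _; rewrite /g alphaR_row mulrC; congr (_ + _).
    by apply: eq_bigr => x _; rewrite alphaX_row.
  rewrite big_split exchange_big; congr (_ + _).
  by apply: eq_bigr => x _; rewrite mulr_suml.
under [RHS]eq_bigr do rewrite gE mulrDl.
rewrite big_split /=.
(* Exchanging the roles of the two points moves the residual onto the
   second argument of A, where it meets the residual of the main term. *)
have -> : \sum_(y : grid M d) v * (\sum_(z : grid M d) A z y) * (w y - v) =
          \sum_(y : grid M d) \sum_(x : grid M d) A y x * (v * (w x - v)).
  rewrite [RHS]exchange_big; apply: eq_bigr => x _ /=.
  by rewrite -mulr_suml; ring.
rewrite -sumrB [LHS](eq_bigr (fun x =>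
  \sum_(y : grid M d) (w x * w y - v * v) * A y x)); last first.
  by move=> x _; rewrite -sumrB; apply: eq_bigr => y _; rewrite mulrBl.
rewrite exchange_big -big_split; apply: eq_bigr => y _ /=.
rewrite mulr_suml -big_split; apply: eq_bigr => x _ /=.
by ring.
Qed.
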